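(* Let $\mathbb{K}\in\{\mathbb{R},\mathbb{C}\}$, $G=\mathrm{GL}_6(\mathbb{K})$. For $x\in G$ define the rank matrix $\mathrm{R}(x)=\begin{bmatrix}\mathrm{rank}_{4\times4}(x)&\mathrm{rank}_{4\times2}(x)\\ \mathrm{rank}_{2\times4}(x)&\mathrm{rank}_{2\times2}(x)\end{bmatrix}$, where $\mathrm{rank}_{i\times j}(x)$ is the rank of the lower right $i\times j$ block of $x$, and for a $2\times2$ integer matrix $R$ put $G_R=\{x\in G:\mathrm{R}(x)=R\}$ (these nonempty sets are exactly the $P$-$P^\tau$ double cosets in $G$, where $P$ is the parabolic subgroup of block upper triangular matrices with three $2\times2$ diagonal blocks). Let $x_{\mathrm{left}}=\begin{bmatrix}0&I_2&0\\0&0&I_2\\0&0&0\end{bmatrix}$, $x_{\mathrm{right}}=x_{\mathrm{left}}^\tau$, let $X_{\mathrm{left}}$ be the left invariant vector field on $G$ whose value at $x$ is $xx_{\mathrm{left}}$, and $X_{\mathrm{right}}$ the right invariant vector field whose value at $x$ is $x_{\mathrm{right}}x$. Let $R$ be such that $G_R\neq\emptyset$ and $R$ is not one of $\begin{bmatrix}4&2\\2&2\end{bmatrix},\begin{bmatrix}4&2\\2&1\end{bmatrix},\begin{bmatrix}3&2\\2&2\end{bmatrix},\begin{bmatrix}3&2\\2&1\end{bmatrix}$. Then either $X_{\mathrm{left}}$ or $X_{\mathrm{right}}$ is transversal to $G_R$.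
   Context: A vector field $X$ on $M$ is transversal to a submanifold $Z$ if $X(z)\notin \mathrm{T}_z(Z)$ for all $z\in Z$. $\tau$ denotes matrix transpose. *)

(* Defs.v *)
From mathcomp Require Import all_boot all_algebra.
From mathcomp Require Import all_classical all_reals all_analysis.
From mathcomp Require Export complex.
Import numFieldNormedType.Exports.

Set Implicit Arguments.
Unset Strict Implicit.
Unset Printing Implicit Defensive.

Local Open Scope classical_set_scope.
Local Open Scope ring_scope.

(* The scalar field K is an arbitrary numFieldType equipped with its norm
   topology; it will be instantiated with R and with C = R[i]. *)

Definition tangent_space (K : numFieldType) (n : nat)
    (Z : set 'M[K]_n) (z : 'M[K]_n) : set 'M[K]_n :=
  [set v | exists gamma : K -> 'M[K]_n,
      [/\ gamma 0 = z,
          (\forall t \near (0 : K), Z (gamma t)) &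
          forall i j : 'I_n,
            (gamma h i j - z i j) / h @[h --> (0 : K)^'] --> v i j]].

Definition transversal (K : numFieldType) (n : nat)
    (X : 'M[K]_n -> 'M[K]_n) (Z : set 'M[K]_n) : Prop :=
  forall z, Z z -> ~ tangent_space Z z (X z).

(* rank of the lower right i x j block of x : 'M_6 (for i, j <= 6). *)
Definition rank_lr (K : numFieldType) (i j : nat) (x : 'M[K]_6) : nat :=
  \rank (\matrix_(a < i, b < j) x (inord (6 - i + a)) (inord (6 - j + b))).

Definition mx2 (a b c d : int) : 'M[int]_2 :=
  \matrix_(i < 2, j < 2)
    (if i == 0 :> nat then (if j == 0 :> nat then a else b)
     else (if j == 0 :> nat then c else d)).

Definition rank_matrix (K : numFieldType) (x : 'M[K]_6) : 'M[int]_2 :=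
  mx2 (rank_lr 4 4 x) (rank_lr 4 2 x) (rank_lr 2 4 x) (rank_lr 2 2 x).

Definition GL6 (K : numFieldType) : set 'M[K]_6 := [set x | x \in unitmx].

Definition G_R (K : numFieldType) (R : 'M[int]_2) : set 'M[K]_6 :=
  [set x | GL6 x /\ rank_matrix x = R].

(* x_left = [[0,I2,0],[0,0,I2],[0,0,0]] : entry (i,j) is 1 iff j = i + 2. *)
Definition x_left (K : numFieldType) : 'M[K]_6 :=
  \matrix_(i < 6, j < 6) (j == i.+2 :> nat)%:R.

Definition x_right (K : numFieldType) : 'M[K]_6 := (x_left K)^T.

Definition X_left (K : numFieldType) (x : 'M[K]_6) : 'M[K]_6 := x *m x_left K.
Definition X_right (K : numFieldType) (x : 'M[K]_6) : 'M[K]_6 := x_right K *m x.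

Definition excluded_R (R : 'M[int]_2) : Prop :=
  R = mx2 4 2 2 2 \/ R = mx2 4 2 2 1 \/ R = mx2 3 2 2 2 \/ R = mx2 3 2 2 1.

Definition prop42_for (K : numFieldType) : Prop :=
  forall R : 'M[int]_2,
    @G_R K R !=set0 -> ~ excluded_R R ->
    transversal (@X_left K) (@G_R K R) \/ transversal (@X_right K) (@G_R K R).

(* Main.v *)
From mathcomp Require Import all_boot all_order all_algebra.
From mathcomp Require Import all_classical all_reals all_analysis.
From mathcomp Require Import complex zify.
Require Import Defs.
Import numFieldNormedType.Exports.

Set Implicit Arguments.
Unset Strict Implicit.
Unset Printing Implicit Defensive.

Import Order.TTheory GRing.Theory Num.Theory.
Local Open Scope classical_set_scope.
Local Open Scope ring_scope.

(* Along a curve through x inside G_R the ranks of the lower right blocks stay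
   constant, so the velocity V of a block B is tangent to the matrices of rank
   at most rank B: W V U = 0 whenever W B = 0 and B U = 0.  For the velocity
   x x_left, whose lower right blocks are the blocks of x shifted two columns
   to the left, this yields rank_{ix4} <= 2 rank_{ix2} and, x being invertible,
   i + rank_{ix2} <= 2 rank_{ix4}, for i = 2, 4.  These inequalities leave only
   the four excluded rank matrices, so X_left alone is transversal to every
   other G_R. *)

(* V is tangent at B to the variety of matrices of rank at most \rank B. *)
Definition rank_tangent (F : fieldType) m n (B V : 'M[F]_(m, n)) : Prop :=
  forall p q (W : 'M[F]_(p, m)) (U : 'M[F]_(n, q)),
    W *m B = 0 -> B *m U = 0 -> W *m V *m U = 0.

Section RankTangentAlgebra.
Variable F : fieldType.

Lemma rank_tangent_mul m n (L : 'M[F]_m) (R : 'M[F]_n) (B V : 'M[F]_(m, n)) :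
  L \in unitmx -> R \in unitmx ->
  rank_tangent B V -> rank_tangent (L *m B *m R) (L *m V *m R).
Proof.
move=> uL uR tBV p q W U WB0 BU0.
rewrite !mulmxA in WB0; rewrite -!mulmxA in BU0.
have WLB0 : W *m L *m B = 0 by rewrite -(mulmxK uR (W *m L *m B)) WB0 mul0mx.
have BRU0 : B *m (R *m U) = 0 by rewrite -(mulKmx uL (B *m _)) BU0 mulmx0.
by have := tBV _ _ _ _ WLB0 BRU0; rewrite !mulmxA.
Qed.

Lemma copid_diag_mx n r :
  copid_mx r = diag_mx (\row_(i < n) (r <= i)%:R) :> 'M[F]_n.
Proof.
apply/matrixP => i j; rewrite !mxE; case: eqVneq => [->|ij].
  rewrite eqxx /= mulr1n; case: leqP => ri; rewrite ?subrr ?subr0 //.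
by rewrite (negbTE (ij : i != j :> nat)) subr0.
Qed.

Lemma rank_tangent_pid m n r (V : 'M[F]_(m, n)) :
  (r <= m)%N -> (r <= n)%N ->
  (forall (a : 'I_m) (b : 'I_n), (r <= a)%N -> (r <= b)%N -> V a b = 0) ->
  rank_tangent (pid_mx r) V.
Proof.
move=> rm rn Vcorner p q W U WP0 PU0.
have WE : W = W *m copid_mx r.
  by rewrite mulmxBr mulmx1 -(@pid_mx_id F m n m r rn) mulmxA WP0 mul0mx subr0.
have UE : U = copid_mx r *m U.
  by rewrite mulmxBl mul1mx -(@pid_mx_id F n m n r rm) -mulmxA PU0 mulmx0 subr0.
have corner0 : copid_mx r *m V *m copid_mx r = 0.
  apply/matrixP => a b; rewrite !copid_diag_mx mul_mx_diag mul_diag_mx !mxE.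
  have [ra|ra] := leqP r a; last by rewrite mul0r mul0r.
  have [rb|rb] := leqP r b; last by rewrite mulr0.
  by rewrite Vcorner // mul1r mulr1.
have -> : W *m V *m U = W *m (copid_mx r *m V *m copid_mx r) *m U.
  by rewrite {1}WE {1}UE !mulmxA.
by rewrite corner0 mulmx0 mul0mx.
Qed.

Lemma rank_tangent_ker m n (B V : 'M[F]_(m, n)) :
  rank_tangent B V -> (kermx B^T *m V^T <= B^T)%MS.
Proof.
move=> tBV; rewrite submxE; apply/eqP.
have cokerB : (cokermx B^T)^T *m B = 0.
  by apply: trmx_inj; rewrite trmx_mul trmxK mulmx_coker trmx0.
have kerB : B *m (kermx B^T)^T = 0.
  by apply: trmx_inj; rewrite trmx_mul trmxK mulmx_ker trmx0.
have /(congr1 trmx) := tBV _ _ _ _ cokerB kerB.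
by rewrite !trmx_mul !trmxK trmx0 mulmxA.
Qed.

Lemma mxrank_col_mx_leq p j k i (C : 'M[F]_(p, j)) (V : 'M[F]_(j, i))
    (B : 'M[F]_(k, i)) :
  (C *m V <= B)%MS -> (\rank (col_mx V B) <= \rank B + (j - \rank C))%N.
Proof.
move=> CVB.
have VBC : (V <= B + C^C *m V)%MS.
  have /(submxMr V) : (1%:M <= C + C^C)%MS by rewrite sub1mx addsmx_compl_full.
  rewrite mul1mx addsmxMr => /submx_trans; apply.
  exact: addsmxS CVB (submx_refl _).
have : (col_mx V B <= B + C^C *m V)%MS.
  by rewrite -addsmxE addsmx_sub VBC addsmxSl.
move/mxrankS/leq_trans; apply; apply: leq_trans (mxrank_adds_leqif _ _).1 _.
by rewrite leq_add2l -mxrank_compl mxrankM_maxl.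
Qed.

Lemma mxrank_leq_lsubmx p k l i (M : 'M[F]_(p, k + l)) (Y2 : 'M[F]_(k, i))
    (Y3 : 'M[F]_(l, i)) :
  M *m col_mx Y2 Y3 = 0 -> (\rank M <= \rank (lsubmx M) + (l - \rank Y3))%N.
Proof.
move=> MY0.
set N := kermx (lsubmx M).
have ME : M = row_mx (lsubmx M) (rsubmx M) by rewrite hsubmxK.
have : (M <= N *m M + N^C *m M)%MS.
  have /(submxMr M) : (1%:M <= N + N^C)%MS by rewrite sub1mx addsmx_compl_full.
  by rewrite mul1mx addsmxMr.
move/mxrankS/leq_trans; apply; apply: leq_trans (mxrank_adds_leqif _ _).1 _.
rewrite addnC; apply: leq_add.
  rewrite (leq_trans (mxrankM_maxl _ _)) //.
  by rewrite mxrank_compl mxrank_ker subKn ?rank_leq_row.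
have -> : N *m M = row_mx 0 (N *m rsubmx M) by rewrite {1}ME mul_mx_row mulmx_ker.
rewrite rank_row_0mx -mxrank_ker mxrankS //; apply/sub_kermxP.
have : lsubmx M *m Y2 + rsubmx M *m Y3 = 0 by rewrite -mul_row_col -ME.
rewrite addrC => /eqP; rewrite addr_eq0 => /eqP MY3.
by rewrite -mulmxA MY3 mulmxN mulmxA mulmx_ker mul0mx oppr0.
Qed.

Lemma mxrank_row_mx_tangent m n (B V : 'M[F]_(m, n)) :
  rank_tangent B V -> (\rank (row_mx V B) <= 2 * \rank B)%N.
Proof.
move=> /rank_tangent_ker /mxrank_col_mx_leq.
by rewrite mxrank_ker subKn ?rank_leq_row // -tr_row_mx !mxrank_tr mul2n -addnn.
Qed.

Lemma mxrank_row_mx_shift_tangent m k (Z1 Z2 Z3 : 'M[F]_(m, k)) :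
  rank_tangent (row_mx Z2 Z3) (row_mx Z1 Z2) ->
  (\rank (row_mx Z1 (row_mx Z2 Z3)) + \rank Z3 <= 2 * \rank (row_mx Z2 Z3))%N.
Proof.
move=> /rank_tangent_ker; rewrite !tr_row_mx.
set B := col_mx Z2^T Z3^T; set C := kermx B => CV.
have CE : C = row_mx (lsubmx C) (rsubmx C) by rewrite hsubmxK.
have Z2B : (Z2^T <= B)%MS by rewrite -addsmxE addsmxSl.
have CZ1 : (lsubmx C *m Z1^T <= B)%MS.
  have -> : lsubmx C *m Z1^T = C *m col_mx Z1^T Z2^T - rsubmx C *m Z2^T.
    by rewrite {2}CE mul_row_col addrK.
  by rewrite addmx_sub // eqmx_opp mulmx_sub.
(* C = kermx B: its left half maps Z1^T into B, and its rows with zero left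
   half lie in the kernel of Z3^T. *)
have rk1 := mxrank_col_mx_leq CZ1.
have rk2 := mxrank_leq_lsubmx (mulmx_ker B).
rewrite mxrank_ker -/C in rk2.
have -> : \rank (row_mx Z1 (row_mx Z2 Z3)) = \rank (col_mx Z1^T B).
  by rewrite -mxrank_tr !tr_row_mx.
have -> : \rank (row_mx Z2 Z3) = \rank B by rewrite -mxrank_tr tr_row_mx.
rewrite -(mxrank_tr Z3).
have := rank_leq_col (lsubmx C); have := rank_leq_row Z3^T; have := rank_leq_row B.
lia.
Qed.

End RankTangentAlgebra.

Lemma det_eq0_mxrank_lt (F : fieldType) n (A : 'M[F]_n) :
  (\rank A < n)%N -> \det A = 0.
Proof.
move=> rkA; apply/eqP; rewrite -[_ == 0]negbK -unitfE -unitmxE.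
by apply: contraTN rkA => /mxrank_unit ->; rewrite ltnn.
Qed.

Lemma mxrank_mxsub (F : fieldType) m n m' n' (f : 'I_m' -> 'I_m)
    (g : 'I_n' -> 'I_n) (A : 'M[F]_(m, n)) :
  (\rank (mxsub f g A) <= \rank A)%N.
Proof.
rewrite mxsubrc (leq_trans (mxrankS (rowsub_sub _ _))) //.
by rewrite -mxrank_tr trmx_mxsub -[X in (_ <= X)%N]mxrank_tr mxrankS ?rowsub_sub.
Qed.

Lemma det_scale_last_row (R : comPzRingType) n (c : R) (A : 'M[R]_n.+1) :
  \det (\matrix_(k, l) (if k == ord_max then c * A k l else A k l)) = c * \det A.
Proof.
have -> : \matrix_(k, l) (if k == ord_max then c * A k l else A k l) =
          diag_mx (\row_k (if k == ord_max then c else 1)) *m A.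
  apply/matrixP => k l; rewrite mul_diag_mx !mxE.
  by case: eqP; rewrite ?mul1r.
rewrite det_mulmx det_diag big_ord_recr /= big1 => [|k _].
  by rewrite mxE eqxx mul1r.
by rewrite mxE ifN // -val_eqE neq_ltn (ltn_ord k).
Qed.

Lemma scalemx_subE (R : comPzRingType) m n (c : R) (A B : 'M[R]_(m, n)) i j :
  (c *: (A - B)) i j = (A i j - B i j) * c.
Proof. by rewrite !mxE mulrC. Qed.

Lemma cvg_of_diff_quotient (K : numFieldType) (f : K -> K) (c v : K) :
  (f h - c) / h @[h --> (0 : K)^'] --> v -> f h @[h --> (0 : K)^'] --> c.
Proof.
move=> df.
have lim : c + h * ((f h - c) / h) @[h --> (0 : K)^'] --> c + 0 * v.
  apply: cvgD; first exact: cvg_cst.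
  by apply: cvgM; [exact: nbhs_dnbhs | exact: df].
rewrite mul0r addr0 in lim; apply: cvg_trans lim; apply: near_eq_cvg; near=> h.
rewrite mulrC divfK; first by rewrite addrC subrK.
by near: h; exact: nbhs_dnbhs_neq.
Unshelve. all: by end_near. Qed.

Section EntrywiseLimits.
Context (K : numFieldType) (T : Type) (F : set_system T) {FF : Filter F}.

Lemma cvg_det n (A : T -> 'M[K]_n) (A0 : 'M[K]_n) :
  (forall i j, A x i j @[x --> F] --> A0 i j) ->
  \det (A x) @[x --> F] --> \det A0.
Proof.
move=> cvgA; rewrite /determinant.
apply: (cvg_big (@add_continuous K)) => s _.
apply: cvgM; first exact: cvg_cst.
apply: (cvg_big (@mul_continuous K)) => i _; exact: cvgA.
Qed.

Lemma cvg_mulmx m k l n (X : 'M[K]_(m, k)) (Y : 'M[K]_(l, n))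
    (D : T -> 'M[K]_(k, l)) (D0 : 'M[K]_(k, l)) :
  (forall i j, D x i j @[x --> F] --> D0 i j) ->
  forall a b, (X *m D x *m Y) a b @[x --> F] --> (X *m D0 *m Y) a b.
Proof.
move=> cvgD a b.
have entryE (M : 'M[K]_(k, l)) :
    (X *m M *m Y) a b = \sum_j (\sum_i X a i * M i j) * Y j b.
  by rewrite mxE; apply: eq_bigr => j _; rewrite mxE.
rewrite (eq_cvg _ _ (fun x => entryE (D x))) entryE.
apply: (cvg_big (@add_continuous K)) => j _.
apply: cvgM; last exact: cvg_cst.
apply: (cvg_big (@add_continuous K)) => i _.
by apply: cvgM; [exact: cvg_cst | exact: cvgD].
Qed.
End EntrywiseLimits.

(* The indices 0, ..., r - 1 followed by c (meaningful when r <= c). *)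
Definition corner_index r k (c : 'I_k) (i : 'I_r.+1) : 'I_k :=
  if (i < r)%N then insubd c i else c.

Lemma corner_indexE r k (c : 'I_k) (i : 'I_r.+1) : (r <= c)%N ->
  val (corner_index c i) = if (i < r)%N then val i else val c.
Proof.
rewrite /corner_index => rc; case: ifP => // ir.
by rewrite val_insubd (ltn_trans (leq_trans ir rc) (ltn_ord c)).
Qed.

(* If N h has rank at most r and N h = pid_mx r + h V + o(h), then the
   (r+1)-minor of N h on rows 0..r-1, a and columns 0..r-1, b vanishes.
   Dividing its last row by h and letting h -> 0 gives a lower triangular
   matrix with diagonal 1, ..., 1, V a b, whence V a b = 0. *)
Section PidCorner.
Variables (K : numFieldType) (m n r : nat) (N : K -> 'M[K]_(m, n)).
Variable V : 'M[K]_(m, n).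
Hypothesis rankN : \forall h \near (0 : K)^', (\rank (N h) <= r)%N.
Hypothesis dN :
  forall i j, (N h i j - pid_mx r i j) / h @[h --> (0 : K)^'] --> V i j.
Variables (a : 'I_m) (b : 'I_n).
Hypotheses (ra : (r <= a)%N) (rb : (r <= b)%N).

Let rows : 'I_r.+1 -> 'I_m := corner_index a.
Let cols : 'I_r.+1 -> 'I_n := corner_index b.

Let rows_max : rows ord_max = a.
Proof. by apply: val_inj; rewrite corner_indexE //= ltnn. Qed.

Let cols_max : cols ord_max = b.
Proof. by apply: val_inj; rewrite corner_indexE //= ltnn. Qed.

Let quotient_minor h : 'M[K]_r.+1 := \matrix_(k, l)
  (if k == ord_max then (N h (rows k) (cols l) - pid_mx r (rows k) (cols l)) / h
   else N h (rows k) (cols l)).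

Let limit_minor : 'M[K]_r.+1 := \matrix_(k, l)
  (if k == ord_max then V (rows k) (cols l) else pid_mx r (rows k) (cols l)).

Let cvg_quotient_minor k l :
  quotient_minor h k l @[h --> (0 : K)^'] --> limit_minor k l.
Proof.
rewrite (eq_cvg _ _ (fun h => mxE _ _ _ _ : quotient_minor h k l = _)).
rewrite [limit_minor k l]mxE.
case: eqP => _; first exact: dN.
apply: cvg_of_diff_quotient; exact: dN.
Qed.

Let quotient_minor_det0 : \forall h \near (0 : K)^', \det (quotient_minor h) = 0.
Proof.
near=> h.
have h0 : h != 0 by near: h; exact: nbhs_dnbhs_neq.
have minorE : mxsub rows cols (N h) = \matrix_(k, l)
    (if k == ord_max then h * quotient_minor h k l else quotient_minor h k l).
  apply/matrixP => k l; rewrite !mxE; case: eqP => [->|_] //.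
  by rewrite rows_max ltnNge ra andbF subr0 mulrC divfK.
apply/(mulfI h0); rewrite mulr0 -det_scale_last_row -minorE.
apply: det_eq0_mxrank_lt; rewrite ltnS (leq_trans (mxrank_mxsub _ _ _)) //.
by near: h.
Unshelve. all: by end_near. Qed.

Let det_limit_minor : \det limit_minor = V a b.
Proof.
rewrite det_trig; last first.
  apply/is_trig_mxP => k l kl.
  have kr : (k < r)%N by rewrite (leq_trans kl) // -ltnS.
  rewrite mxE ifN -?val_eqE ?neq_ltn ?kr // mxE !corner_indexE // kr.
  by case: ifP => [_|lr]; rewrite ?(ltn_eqF kl) // ltn_eqF // (leq_trans kr).
rewrite big_ord_recr /= big1 ?mul1r => [|k _].
  by rewrite mxE eqxx rows_max cols_max.
rewrite mxE ifN -?val_eqE ?neq_ltn ?(ltn_ord k) // mxE !corner_indexE //=.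
by rewrite ltn_ord eqxx ltn_ord.
Qed.

Lemma pid_corner_deriv_eq0 : V a b = 0.
Proof.
have to_limit : \det (quotient_minor h) @[h --> (0 : K)^'] --> \det limit_minor.
  exact: cvg_det cvg_quotient_minor.
have to_zero : \det (quotient_minor h) @[h --> (0 : K)^'] --> 0.
  exact: cvg_near_cst quotient_minor_det0.
by rewrite -det_limit_minor; apply: (cvg_unique (@norm_hausdorff K K^o) to_limit).
Qed.

End PidCorner.

Lemma rank_tangent_of_curve (K : numFieldType) m n (M : K -> 'M[K]_(m, n))
    (B V : 'M[K]_(m, n)) :
  (\forall h \near (0 : K)^', (\rank (M h) <= \rank B)%N) ->
  (forall i j, (M h i j - B i j) / h @[h --> (0 : K)^'] --> V i j) ->
  rank_tangent B V.
Proof.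
move=> rankM dM.
set L := col_ebase B; set R := row_ebase B; set r := \rank B.
have uL : L \in unitmx := col_ebase_unit B.
have uR : R \in unitmx := row_ebase_unit B.
have pidE : pid_mx r = invmx L *m B *m invmx R.
  by rewrite -[in RHS](mulmx_ebase B) !mulmxA mulVmx // mul1mx mulmxK.
have VE : V = L *m (invmx L *m V *m invmx R) *m R.
  by rewrite !mulmxA mulmxV // mul1mx mulmxKV.
rewrite -(mulmx_ebase B) VE; apply: rank_tangent_mul => //.
apply: rank_tangent_pid; rewrite ?rank_leq_row ?rank_leq_col // => a b ra rb.
apply: (pid_corner_deriv_eq0 (r := r) (N := fun h => invmx L *m M h *m invmx R)) => //.
  apply: filterS rankM => h rkM.
  exact: leq_trans (mxrankM_maxl _ _) (leq_trans (mxrankM_maxr _ _) rkM).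
move=> i j.
have quotE h : ((invmx L *m M h *m invmx R) i j - pid_mx r i j) / h =
               (invmx L *m (h^-1 *: (M h - B)) *m invmx R) i j.
  by rewrite pidE -scalemxAr -scalemxAl mulmxBr mulmxBl scalemx_subE.
rewrite (eq_cvg _ _ quotE); apply: cvg_mulmx => i' j'.
by rewrite (eq_cvg _ _ (fun h => scalemx_subE h^-1 (M h) B i' j')).
Qed.

Ltac ord_lia := repeat match goal with
  | o : 'I_?n |- _ => lazymatch goal with
      | _ : is_true (nat_of_ord o < n)%N |- _ => fail
      | _ => have := ltn_ord o; intro end end; lia.

Section LowerRightBlocks.
Variable K : numFieldType.
Implicit Types x : 'M[K]_6.

Definition lr_block i j x : 'M[K]_(i, j) :=
  \matrix_(a < i, b < j) x (inord (6 - i + a)) (inord (6 - j + b)).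

Definition ll_block i x : 'M[K]_(i, 2) :=
  \matrix_(a < i, b < 2) x (inord (6 - i + a)) (inord b).

Lemma lr_blockE i j x a b :
  lr_block i j x a b = x (inord (6 - i + a)) (inord (6 - j + b)).
Proof. exact: mxE. Qed.

Lemma rank_lrE i j x : rank_lr i j x = \rank (lr_block i j x).
Proof. by []. Qed.

Lemma X_left_entry x (p q : 'I_6) :
  (2 <= q)%N -> X_left x p q = x p (inord (q - 2)).
Proof.
move=> q2; rewrite mxE (bigD1 (inord (q - 2))) //= big1 ?addr0 => [|j jq].
  rewrite mxE inordK; last ord_lia.
  have -> : (q - 2).+2 = q :> nat by lia.
  by rewrite eqxx mulr1.
rewrite mxE; case: eqP => [qj|]; last by rewrite mulr0.
by case/eqP: jq; apply: val_inj; rewrite /= inordK qj; ord_lia.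
Qed.

Lemma lr_block4 i x :
  lr_block i 4 x = row_mx (lr_block i 2 (X_left x)) (lr_block i 2 x).
Proof.
apply/matrixP => a c; case: (@split_ordP 2 2 c) => c' ->;
  rewrite ?(row_mxEl (n1 := 2)) ?(row_mxEr (n1 := 2)) !lr_blockE ?X_left_entry /=;
  try ord_lia.
all: try (congr (x _ _); apply: val_inj); rewrite /= ?inordK; ord_lia.
Qed.

Lemma lr_block4_X_left i x :
  lr_block i 4 (X_left x) = row_mx (ll_block i x) (lr_block i 2 (X_left x)).
Proof.
apply/matrixP => a c; case: (@split_ordP 2 2 c) => c' ->;
  rewrite ?(row_mxEl (n1 := 2)) ?(row_mxEr (n1 := 2)) !lr_blockE ?X_left_entry;
  rewrite ?mxE.
all: try (congr (x _ _); apply: val_inj); rewrite /= ?inordK; ord_lia.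
Qed.

Lemma mxrank_bottom_rows i x : (i <= 6)%N -> x \in unitmx ->
  \rank (row_mx (ll_block i x) (lr_block i 4 x)) = i.
Proof.
move=> i6 ux; set f := fun a : 'I_i => inord (6 - i + a) : 'I_6.
have -> : row_mx (ll_block i x) (lr_block i 4 x) = rowsub f x.
  apply/matrixP => a c; case: (@split_ordP 2 4 c) => c' ->;
    rewrite ?(row_mxEl (n1 := 2)) ?(row_mxEr (n1 := 2)) ?lr_blockE !mxE;
    congr (x _ _); apply: val_inj; rewrite /= inordK; ord_lia.
rewrite rowsubE mxrankMfree ?row_free_unit //.
apply/eqP; rewrite eqn_leq rank_leq_row /=.
have f_inj : injective f.
  move=> a b /(congr1 val); rewrite /= !inordK; try ord_lia.
  by move=> ab; apply: val_inj => /=; lia.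
have orth : rowsub f 1%:M *m (rowsub f 1%:M)^T = 1%:M :> 'M[K]_i.
  apply/matrixP => a b; rewrite -rowsubE !mxE.
  by rewrite (inj_eq f_inj) eq_sym.
by rewrite -[X in (X <= _)%N](mxrank1 K i) -orth mxrankM_maxl.
Qed.

Lemma rank_tangent_lr_block i j x (V : 'M[K]_6) (gamma : K -> 'M[K]_6) :
  (\forall h \near (0 : K)^', rank_lr i j (gamma h) = rank_lr i j x) ->
  (forall p q, (gamma h p q - x p q) / h @[h --> (0 : K)^'] --> V p q) ->
  rank_tangent (lr_block i j x) (lr_block i j V).
Proof.
move=> rank_gamma dgamma.
apply: (rank_tangent_of_curve (M := fun h => lr_block i j (gamma h))).
  by apply: filterS rank_gamma => h /eqP; rewrite eqn_leq => /andP[].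
move=> a b; rewrite !lr_blockE; under eq_cvg do rewrite lr_blockE.
exact: dgamma.
Qed.

Lemma lr_block_rank_ineqs i x : (i <= 6)%N -> x \in unitmx ->
  rank_tangent (lr_block i 2 x) (lr_block i 2 (X_left x)) ->
  rank_tangent (lr_block i 4 x) (lr_block i 4 (X_left x)) ->
  (rank_lr i 4 x <= 2 * rank_lr i 2 x)%N /\
  (i + rank_lr i 2 x <= 2 * rank_lr i 4 x)%N.
Proof.
move=> i6 ux tangent2 tangent4; rewrite !rank_lrE; split.
  by rewrite lr_block4; exact: mxrank_row_mx_tangent.
have := mxrank_row_mx_shift_tangent (Z1 := ll_block i x)
  (Z2 := lr_block i 2 (X_left x)) (Z3 := lr_block i 2 x).
by rewrite -lr_block4 -lr_block4_X_left mxrank_bottom_rows // => /(_ tangent4).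
Qed.

End LowerRightBlocks.

Lemma rank_lr_eq_of_rank_matrix (K : numFieldType) (x y : 'M[K]_6) i j :
  rank_matrix y = rank_matrix x -> i \in [:: 2; 4]%N -> j \in [:: 2; 4]%N ->
  rank_lr i j y = rank_lr i j x.
Proof.
move=> /matrixP eqR; rewrite !inE => /orP[]/eqP-> /orP[]/eqP->.
- by have := eqR 1 1; rewrite !mxE => -[].
- by have := eqR 1 0; rewrite !mxE => -[].
- by have := eqR 0 1; rewrite !mxE => -[].
- by have := eqR 0 0; rewrite !mxE => -[].
Qed.

Lemma excluded_of_rank_bounds (r44 r42 r24 r22 : nat) :
  (r44 <= 4)%N -> (r42 <= 2)%N -> (r24 <= 2)%N -> (r22 <= 2)%N ->
  (r44 <= 2 * r42)%N -> (4 + r42 <= 2 * r44)%N ->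
  (r24 <= 2 * r22)%N -> (2 + r22 <= 2 * r24)%N ->
  excluded_R (mx2 r44 r42 r24 r22).
Proof.
move=> *; have -> : r42 = 2 by lia. have -> : r24 = 2 by lia.
(have [->|->] : r44 = 4 \/ r44 = 3 by lia);
  (have [->|->] : r22 = 2 \/ r22 = 1 by lia);
  by [left | right; left | right; right; left | right; right; right].
Qed.

Lemma X_left_transversal (K : numFieldType) (R : 'M[int]_2) :
  ~ excluded_R R -> transversal (@X_left K) (@G_R K R).
Proof.
move=> notR x [ux Rx] [gamma [_ near_GR dgamma]]; apply: notR.
have near_rank : \forall h \near (0 : K)^', rank_matrix (gamma h) = rank_matrix x.
  by apply: nbhs_dnbhs; apply: filterS near_GR => h [_ ->].
have tangent (i j : nat) : i \in [:: 2; 4]%N -> j \in [:: 2; 4]%N ->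
    rank_tangent (lr_block i j x) (lr_block i j (X_left x)).
  move=> ij jj; apply: rank_tangent_lr_block dgamma.
  by apply: filterS near_rank => h rkh; exact: rank_lr_eq_of_rank_matrix rkh ij jj.
have [ineq4 ineq4'] :=
  lr_block_rank_ineqs (i := 4) isT ux (tangent 4 2 isT isT) (tangent 4 4 isT isT).
have [ineq2 ineq2'] :=
  lr_block_rank_ineqs (i := 2) isT ux (tangent 2 2 isT isT) (tangent 2 4 isT isT).
rewrite -Rx; apply: excluded_of_rank_bounds => //;
  first [exact: rank_leq_row | exact: rank_leq_col].
Qed.

Theorem proposition4p2 (R : realType) :
  prop42_for (R : numFieldType) /\ prop42_for ((R[i] : numClosedFieldType) : numFieldType).
Proof. by split=> S _ notS; left; exact: X_left_transversal. Qed.
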